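(* Let $\mathcal{X}$ be a finite set, $\pi$ a strictly positive probability distribution on $\mathcal{X}$ with $\pi_{\min}:=\min_x\pi(x)>0$, and $P$ an irreducible, aperiodic, $\pi$-reversible transition matrix on $\mathcal{X}$ with absolute spectral gap $\gamma_*$. Let $\varepsilon>0$. (i) If $\varepsilon<\frac{\pi_{\min}^3}{4}$, then $$\frac{1-\gamma_*}{2}\,t_{\mathrm{mix}}^{(\mathrm{TV})}(\varepsilon,P)\le\bar t_{\mathrm{mix}}^{(\mathrm{TV})}(\varepsilon,P)\le t_{\mathrm{mix}}^{(\mathrm{TV})}(\varepsilon,P).$$ (ii) Let $\alpha\in(0,1)\cup(1,\infty)$ and $\varepsilon_0:=\min\left\{\frac1{2|\alpha-1|},\frac{4\alpha}{|\alpha-1|},\frac{|\alpha-1|\pi_{\min}^6}{128\alpha},\frac{\alpha|\alpha-1|\pi_{\min}^6}{2048}\right\}$. If $\varepsilon<\varepsilon_0$, then $$\frac{1-\gamma_*}{4}\,t_{\mathrm{mix}}^{(D_\alpha)}(\varepsilon,P)\le\bar t_{\mathrm{mix}}^{(D_\alpha)}(\varepsilon,P)\le t_{\mathrm{mix}}^{(D_\alpha)}(\varepsilon,P).$$ (iii) Let $\alpha\in(0,1)\cup(1,\infty)$ and $\varepsilon_0$ as in (ii). If $\varepsilon<\frac1{\alpha-1}\ln(1+(\alpha-1)\varepsilon_0)$, then $$\frac{1-\gamma_*}{4}\,t_{\mathrm{mix}}^{(R_\alpha)}(\varepsilon,P)\le\bar t_{\mathrm{mix}}^{(R_\alpha)}(\varepsilon,P)\le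 t_{\mathrm{mix}}^{(R_\alpha)}(\varepsilon,P).$$
   Context: $P$ is $\pi$-reversible if $\pi(x)P(x,y)=\pi(y)P(y,x)$ for all $x,y$. The absolute spectral gap is $\gamma_*:=1-\lambda_*$ with $\lambda_*:=\max\{|\lambda|:\lambda\text{ an eigenvalue of }P,\ \lambda\ne1\}$. $\Pi(x,y):=\pi(y)$ for all $x,y$. Average ($\pi$-weighted) divergences: $D_\alpha(P^t\|\Pi)=\frac1{\alpha-1}\left(\sum_{x,y}\pi(x)\pi(y)\left(\frac{P^t(x,y)}{\pi(y)}\right)^\alpha-1\right)$, $R_\alpha(P^t\|\Pi)=\frac1{\alpha-1}\ln(1+(\alpha-1)D_\alpha(P^t\|\Pi))$, $\mathrm{TV}(P^t,\Pi)=\frac12\sum_{x,y}\pi(x)|P^t(x,y)-\pi(y)|$. Worst-case divergences: $d^{(D_\alpha)}(t)=\max_x\frac1{\alpha-1}\left(\sum_y\pi(y)\left(\frac{P^t(x,y)}{\pi(y)}\right)^\alpha-1\right)$, $d^{(R_\alpha)}(t)=\max_x\frac1{\alpha-1}\ln\left(\sum_y\pi(y)\left(\frac{P^t(x,y)}{\pi(y)}\right)^\alpha\right)$, $d^{(\mathrm{TV})}(t)=\max_x\frac12\sum_y|P^t(x,y)-\pi(y)|$. Mixing times ($t$ ranging over positive integers): $\bar t_{\mathrm{mix}}^{(D_\alpha)}(\varepsilon,P)=\inf\{t>0:D_\alpha(P^t\|\Pi)<\varepsilon\}$, $\bar t_{\mathrm{mix}}^{(R_\alpha)}(\varepsilon,P)=\inf\{t>0:R_\alpha(P^t\|\Pi)<\varepsilon\}$,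 $\bar t_{\mathrm{mix}}^{(\mathrm{TV})}(\varepsilon,P)=\inf\{t>0:\mathrm{TV}(P^t,\Pi)<\varepsilon\}$, and $t_{\mathrm{mix}}^{(\ast)}(\varepsilon,P)=\inf\{t>0:d^{(\ast)}(t)<\varepsilon\}$ for $\ast\in\{D_\alpha,R_\alpha,\mathrm{TV}\}$. *)

(* Defs.v *)
From mathcomp Require Import all_boot all_order all_algebra.
From mathcomp Require Import boolp classical_sets reals ereal exp.
Set Implicit Arguments.
Unset Strict Implicit.
Unset Printing Implicit Defensive.
Import Order.TTheory GRing.Theory Num.Theory.
Local Open Scope classical_set_scope.
Local Open Scope ring_scope.

Section Chains.
Context {R : realType} {X : finType}.
Implicit Types (p : X -> R) (P Q : X -> X -> R) (alpha eps : R).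

Definition pos_distribution p : Prop :=
  (forall x, 0 < p x) /\ \sum_x p x = 1.

Definition transition_matrix P : Prop :=
  (forall x y, 0 <= P x y) /\ (forall x, \sum_y P x y = 1).

Definition reversible p P : Prop :=
  forall x y, p x * P x y = p y * P y x.

(* [P] as a square matrix, its rows and columns indexed along [enum X]. *)
Definition kernel_mx P : 'M[R]_(#|X|) :=
  \matrix_(i, j) P (enum_val i) (enum_val j).

Definition kernel_pow P (t : nat) (x y : X) : R :=
  (kernel_mx P ^+ t) (enum_rank x) (enum_rank y).

Definition irreducible_chain P : Prop :=
  forall x y, exists t, 0 < kernel_pow P t x y.

(* [d] is the gcd of the set of the possible return times to [x]. *)
Definition is_period P (x : X) (d : nat) : Prop :=
  let divides_returns k :=
    forall t, (0 < t)%N -> 0 < kernel_pow P t x x -> (k %| t)%N in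
  divides_returns d /\ forall k, divides_returns k -> (k %| d)%N.

Definition aperiodic_chain P : Prop := forall x, is_period P x 1.

(* Maximum and minimum over [X], which is nonempty as soon as it carries a
   probability distribution. *)
Definition max_over (f : X -> R) : R := sup (range f).
Definition min_over (f : X -> R) : R := inf (range f).

(* The set is finite, so that [sup] is a maximum, except when #|X| = 1: the set
   is then empty and [sup set0 = 0]. Real eigenvalues are enough, since all the
   eigenvalues of a reversible [P] are real. *)
Definition lambda_star P : R :=
  sup [set `|l| | l in [set l : R | eigenvalue (kernel_mx P) l /\ l != 1]].

Definition abs_spectral_gap P : R := 1 - lambda_star P.

Definition stationary_kernel p : X -> X -> R := fun _ y => p y.

(* In the divergences below, [Q] is to be instantiated with a power of [P]. The
   base of [`^] is nonnegative, and [0 `^ alpha = 0] for [alpha != 0]. *)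
Definition avg_D alpha p Q : R :=
  (alpha - 1)^-1 *
  (\sum_x \sum_y p x * p y * (Q x y / stationary_kernel p x y) `^ alpha - 1).

Definition avg_R alpha p Q : R :=
  (alpha - 1)^-1 * ln (1 + (alpha - 1) * avg_D alpha p Q).

Definition avg_TV p Q : R :=
  2^-1 * \sum_x \sum_y p x * `|Q x y - stationary_kernel p x y|.

Definition worst_D alpha p Q : R :=
  max_over (fun x =>
    (alpha - 1)^-1 * (\sum_y p y * (Q x y / p y) `^ alpha - 1)).

Definition worst_R alpha p Q : R :=
  max_over (fun x =>
    (alpha - 1)^-1 * ln (\sum_y p y * (Q x y / p y) `^ alpha)).

Definition worst_TV p Q : R :=
  max_over (fun x => 2^-1 * \sum_y `|Q x y - p y|).

(* Infimum in the extended reals: it is +oo if the threshold is never met. *)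
Definition mixing_time (div : (X -> X -> R) -> R) eps P : \bar R :=
  ereal_inf [set (t%:R)%:E | t in
    [set t : nat | (0 < t)%N /\ div (kernel_pow P t) < eps]].

Definition eps0 alpha p : R :=
  let pmin := min_over p in
  Num.min (1 / (2 * `|alpha - 1|))
 (Num.min (4 * alpha / `|alpha - 1|)
 (Num.min (`|alpha - 1| * pmin ^+ 6 / (128 * alpha))
          (alpha * `|alpha - 1| * pmin ^+ 6 / 2048))).

End Chains.

(* Main.v *)
(* Write [v t x y = P^t x y / p y - 1]. Stationarity gives the semigroup law
   [v (s + t) x y = \sum_z p z * v s x z * v t z y], so once the average
   divergence at time [t] is below the threshold, the pointwise deviation at time
   [2t] or [4t] is quadratically or quartically smaller, and the worst case is
   under the same [eps]. Nothing more is used of the spectrum than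
   [0 <= lambda_star <= 1]. For [D_alpha] the comparison with the chi-square
   [\sum p p v^2] rests on two-sided quadratic bounds for the generator
   [(u^alpha - 1 - alpha (u - 1)) / (alpha - 1)], both consequences of
   Bernoulli's inequality, and [R_alpha] is an increasing function of
   [D_alpha]. *)
Require Import Defs.
From mathcomp Require Import all_boot all_order all_algebra.
From mathcomp Require Import boolp classical_sets reals ereal exp.
From mathcomp Require Import sequences ring lra.
Set Implicit Arguments.
Unset Strict Implicit.
Unset Printing Implicit Defensive.
Import Order.TTheory GRing.Theory Num.Theory.
Local Open Scope classical_set_scope.
Local Open Scope ring_scope.

(** * Two-sided quadratic bounds for the Tsallis generator *)

Section Tsallis.
Context {R : realType}.
Implicit Types a m r s u v x : R.

(** Weighted AM-GM by way of tangent lines: with [z = r * ln x], the bounds [1 + y <= expR y] at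
    [- z] and at [ln x - z] are averaged with weights [1 - r] and [r], and the linear terms
    cancel. *)
Lemma powR_le_Bernoulli r x : 0 <= r <= 1 -> 0 <= x ->
  x `^ r <= 1 + r * (x - 1).
Proof.
move=> /andP[r0 r1]; rewrite le_eqVlt => /predU1P[<-|x0].
  by rewrite /powR eqxx; case: eqVneq => [->|_] /=; lra.
rewrite /powR gt_eqF//; set z := r * ln x.
have e1 : expR z * (1 - z) <= 1.
  have := expR_ge1Dx (- z); rewrite expRN => h.
  by rewrite -[leRHS](mulfV (lt0r_neq0 (expR_gt0 z))) ler_pM2l ?expR_gt0.
have e2 : expR z * (1 + (ln x - z)) <= x.
  have xE : x = expR z * expR (ln x - z).
    by rewrite -expRD addrC subrK lnK.
  by rewrite [leRHS]xE ler_pM2l ?expR_gt0// expR_ge1Dx.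
have e3 : (1 - r) * (expR z * (1 - z)) <= 1 - r by rewrite ler_piMr ?subr_ge0.
have e4 : r * (expR z * (1 + (ln x - z))) <= r * x by rewrite ler_wpM2l.
have -> : expR z = (1 - r) * (expR z * (1 - z)) + r * (expR z * (1 + (ln x - z))).
  by rewrite /z; ring.
lra.
Qed.

(** Where [1 + r * (x - 1)] is positive, the previous inequality applies to it with exponent [r^-1],
    and raising to the power [r] inverts it. *)
Lemma powR_ge_Bernoulli r x : 1 <= r -> 0 <= x ->
  1 + r * (x - 1) <= x `^ r.
Proof.
move=> r1 x0; have [b0|b0] := lerP (1 + r * (x - 1)) 0.
  exact: le_trans b0 (powR_ge0 _ _).
have r0 : 0 < r by lra.
have ri : 0 <= r^-1 <= 1 by rewrite invr_ge0 ltW//= invf_le1.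
have := powR_le_Bernoulli ri (ltW b0).
have -> : 1 + r^-1 * (1 + r * (x - 1) - 1) = x by field; rewrite gt_eqF.
move=> h.
have := ge0_ler_powR (ltW r0) (powR_ge0 _ _) x0 h.
rewrite -powRrM mulVf ?gt_eqF// powRr1; [exact: id|exact: ltW].
Qed.

(* Its [p]-average along [u = Q x / p] is the [D_alpha] divergence of the row
   [Q x], because the subtracted linear term has mean zero. *)
Definition tsallis a u : R := (a - 1)^-1 * (u `^ a - 1 - a * (u - 1)).

(* Bernoulli's inequality in the variable [sqrt u] keeps a square that it loses
   in the variable [u]. *)
Lemma tsallis_ge a u : 0 < a -> a != 1 -> 0 <= u ->
  Num.min a 1 * (Num.sqrt u - 1) ^+ 2 <= tsallis a u.
Proof.
move=> a0 a1 u0; rewrite /tsallis.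
have uE : u `^ a = Num.sqrt u `^ (2 * a).
  by rewrite powRrM powR_mulrn ?sqrtr_ge0// sqr_sqrtr.
have := sqr_sqrtr u0; have := sqrtr_ge0 u; rewrite uE.
move: (Num.sqrt u) => s s0 <-{uE}.
have q0 := sqr_ge0 (s - 1).
have sE : 0 < 2 * a -> s `^ (2 * a) = s * s `^ (2 * a - 1).
  by move=> ?; rewrite mulr_powRB1.
have [{}a1|a1'|/eqP] := ltgtP a 1; last by rewrite (negbTE a1).
  rewrite -ler_ndivlMl ?invrK ?invr_lt0 ?subr_lt0//.
  have aa : a * (s - 1) ^+ 2 * (1 - a) <= a * (s - 1) ^+ 2.
    by have := mulr_ge0 (mulr_ge0 (ltW a0) (ltW a0)) q0; lra.
  have aa' : a * (s - 1) ^+ 2 * (1 - a) <= (1 - a) * (s - 1) ^+ 2.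
    by have := mulr_ge0 (sqr_ge0 (1 - a)) q0; lra.
  (* For [2 * a <= 1] Bernoulli applies directly and leaves [a * (s - 1) ^+ 2]. Otherwise a factor
     [s] is split off so that the exponent [2 * a - 1] lies in the unit interval, which leaves
     [(1 - a) * (s - 1) ^+ 2]. *)
  have [ah|ah] := lerP (2 * a) 1.
    have := @powR_le_Bernoulli (2 * a) s; rewrite ah; lra.
  have := @powR_le_Bernoulli (2 * a - 1) s.
  have -> : 0 <= 2 * a - 1 <= 1 by lra.
  by rewrite sE ?mulr_gt0// => /(_ isT s0) /(ler_wpM2l s0); lra.
rewrite mul1r ler_pdivlMl ?subr_gt0//.
have := @powR_ge_Bernoulli (2 * a - 1) s.
have -> : 1 <= 2 * a - 1 by lra.
by rewrite sE ?mulr_gt0// => /(_ isT s0) /(ler_wpM2l s0); lra.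
Qed.

(** With [s = sqrt u], the square [(u - 1) ^+ 2] is [(s - 1) ^+ 2 * (s + 1) ^+ 2], and
    [m * (s + 1) ^+ 2 <= m * (2 * u + 2) <= 4]. *)
Lemma tsallis_ge_sqr a u m : 0 < a -> a != 1 ->
  0 < m <= 1 -> 0 <= u -> u * m <= 1 ->
  Num.min a 1 * m / 4 * (u - 1) ^+ 2 <= tsallis a u.
Proof.
move=> a0 a1 /andP[m0 m1] u0 um; apply: le_trans (tsallis_ge a0 a1 u0).
have min0 : 0 <= Num.min a 1 by rewrite le_min ltW//= ler01.
rewrite -mulrA -mulrA ler_wpM2l//.
have := sqr_sqrtr u0; have := sqrtr_ge0 u; move: (Num.sqrt u) => s s0 uE.
rewrite -uE in um *.
have ms : m * (s + 1) ^+ 2 <= 4.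
  have : m * (s + 1) ^+ 2 <= m * (2 * s ^+ 2 + 2).
    by rewrite ler_pM2l// -subr_ge0; have := sqr_ge0 (s - 1); lra.
  lra.
have := mulr_ge0 (sqr_ge0 (s - 1)) (eqbRL (subr_ge0 _ _) ms); lra.
Qed.

Lemma tsallis_le a v : 0 < a -> a != 1 -> `|v| <= 1 / 2 -> a * `|v| <= 1 / 2 ->
  tsallis a (1 + v) <= 2 * a * v ^+ 2.
Proof.
move=> a0 a1 v2 av2; rewrite /tsallis.
have [vl vu] : - (1 / 2) <= v /\ v <= 1 / 2 by move: v2; rewrite ler_norml => /andP.
have [avl avu] : - (1 / 2) <= a * v /\ a * v <= 1 / 2.
  by move: av2; rewrite -{1}(gtr0_norm a0) -normrM ler_norml => /andP.
have u0 : 0 < 1 + v by lra.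
(* In absolute value, [(a - 1) * v] is at most [v] if [a <= 1] and at most [a * v] if [a > 1]. *)
have d2 : 1 / 2 <= 1 - (a - 1) * v.
  by have [a1'|a1'] := lerP a 1; nra.
have d0 : 0 < 1 - (a - 1) * v by lra.
have key : (a - 1)^-1 * (1 + v) `^ a <=
           (a - 1)^-1 * ((1 + v) / (1 - (a - 1) * v)).
  have [{}a1|a1'|/eqP] := ltgtP a 1; last by rewrite (negbTE a1).
    rewrite ler_nM2l ?invr_lt0 ?subr_lt0// ler_pdivrMr//.
    have ra : 0 <= 1 - a <= 1 by lra.
    have /(ler_wpM2l (powR_ge0 (1 + v) a)) := powR_le_Bernoulli ra (ltW u0).
    rewrite -powRD; last by rewrite subrKC oner_eq0.
    rewrite subrKC powRr1 ?(ltW u0)//; set w := (1 + v) `^ a.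
    by have -> : 1 - (a - 1) * v = 1 + (1 - a) * (1 + v - 1) by ring.
  rewrite ler_pM2l ?invr_gt0 ?subr_gt0// ler_pdivlMr//.
  (* Bernoulli at the inverse of [1 + v], since an upper bound on the power is wanted here. *)
  have ui0 : 0 <= (1 + v)^-1 by rewrite invr_ge0 ltW.
  have := powR_ge_Bernoulli (ltW a1') ui0.
  have -> : (1 + v)^-1 `^ a = ((1 + v) `^ a)^-1.
    by rewrite -powR_inv1 ?(ltW u0)// powRAC powR_inv1 ?powR_ge0.
  have w0 : 0 < (1 + v) `^ a by rewrite powR_gt0.
  move: ((1 + v) `^ a) w0 => w w0.
  move=> /(ler_wpM2l (ltW w0)); rewrite mulfV ?gt_eqF//.
  move=> /(ler_wpM2r (ltW u0)); rewrite mul1r.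
  apply: le_trans; rewrite le_eqVlt; apply/orP; left; apply/eqP.
  by field; rewrite gt_eqF.
rewrite -addrA mulrDr; apply: (le_trans (lerD key (lexx _))).
have -> : (a - 1)^-1 * ((1 + v) / (1 - (a - 1) * v)) +
          (a - 1)^-1 * (- 1 - a * (1 + v - 1)) = a * v ^+ 2 / (1 - (a - 1) * v).
  by field; rewrite gt_eqF//= subr_eq0.
rewrite ler_pdivrMr// -subr_ge0.
have -> : 2 * a * v ^+ 2 * (1 - (a - 1) * v) - a * v ^+ 2 =
          a * v ^+ 2 * (2 * (1 - (a - 1) * v) - 1) by ring.
by apply: mulr_ge0; [exact: mulr_ge0 (ltW a0) (sqr_ge0 v)|lra].
Qed.

End Tsallis.

(** * Extrema and means over a finite set *)

Section Extrema.
Context {R : realType} {X : finType}.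
Implicit Types f g p : X -> R.

Lemma ge_max_over f x : f x <= max_over f.
Proof.
apply: ub_le_sup; last by exists x.
exists (\big[Num.max/f x]_y f y) => _ [y _ <-].
exact: le_bigmax.
Qed.

(** The supremum is attained because [X] is finite, so the inequality stays strict; [x0] excludes an
    empty range, whose [sup] is 0 by default. *)
Lemma max_over_lt (x0 : X) f e : (max_over f < e) <-> (forall x, f x < e).
Proof.
split=> [fe x|fe]; first exact: le_lt_trans (ge_max_over f x) fe.
case: (@arg_maxP _ _ X x0 xpredT f isT) => x _ xmax.
apply: le_lt_trans (fe x); apply: ge_sup; first by exists (f x0), x0.
by move=> _ [y _ <-]; exact: xmax.
Qed.

Lemma min_over_le f x : min_over f <= f x.
Proof.
apply: ge_inf; last by exists x.
exists (\big[Num.min/f x]_y f y) => _ [y _ <-].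
exact: bigmin_le.
Qed.

Lemma min_over_gt0 (x0 : X) f : (forall x, 0 < f x) -> 0 < min_over f.
Proof.
move=> f0; case: (@arg_minP _ _ X x0 xpredT f isT) => x _ xmin.
apply: lt_le_trans (f0 x) _; apply: lb_le_inf; first by exists (f x0), x0.
by move=> _ [y _ <-]; exact: xmin.
Qed.

Lemma mean_le_max_over p f : pos_distribution p ->
  \sum_x p x * f x <= max_over f.
Proof.
move=> [p0 p1]; rewrite -[leRHS]mul1r -p1 mulr_suml.
by apply: ler_sum => x _; rewrite ler_pM2l// ge_max_over.
Qed.

Lemma distribution_inhabited p : pos_distribution p -> exists x : X, True.
Proof.
move=> [_ p1]; case: (pickP X) => [x _|X0]; first by exists x.
by move: p1; rewrite big_pred0// => /esym/eqP; rewrite oner_eq0.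
Qed.

Lemma distribution_le1 p x : pos_distribution p -> p x <= 1.
Proof.
move=> [p0 <-]; rewrite (bigD1 x)//= lerDl.
by apply: sumr_ge0 => y _; exact: ltW.
Qed.

End Extrema.

(** * Powers of the kernel and the size of its eigenvalues *)

Section Powers.
Context {R : realType} {X : finType}.
Implicit Types (p : X -> R) (P Q : X -> X -> R).

Lemma kernel_pow0 P x y : kernel_pow P 0 x y = (x == y)%:R.
Proof. by rewrite /kernel_pow expr0 mxE (inj_eq enum_rank_inj). Qed.

Lemma kernel_powD P s t x y :
  kernel_pow P (s + t) x y = \sum_z kernel_pow P s x z * kernel_pow P t z y.
Proof.
rewrite /kernel_pow exprD mxE (reindex enum_rank)//=.
exact: onW_bij (enum_rank_bij X).
Qed.

Lemma kernel_pow1 P x y : kernel_pow P 1 x y = P x y.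
Proof. by rewrite /kernel_pow expr1 mxE !enum_rankK. Qed.

Definition stationary p Q := forall y, \sum_x p x * Q x y = p y.

Lemma kernel_pow_transition P t :
  transition_matrix P -> transition_matrix (kernel_pow P t).
Proof.
move=> [P0 P1]; elim: t => [|t [IH0 IH1]]; split=> [x y|x].
- by rewrite kernel_pow0 ler0n.
- under eq_bigr do rewrite kernel_pow0.
  rewrite (bigD1 x)//= eqxx big1 ?addr0// => y.
  by rewrite eq_sym => /negPf ->.
- rewrite -addn1 kernel_powD; apply: sumr_ge0 => z _.
  by rewrite kernel_pow1 mulr_ge0.
- under eq_bigr do rewrite -addn1 kernel_powD.
  rewrite exchange_big /= -[RHS](IH1 x); apply: eq_bigr => z _.
  rewrite -mulr_sumr; under eq_bigr do rewrite kernel_pow1.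
  by rewrite P1 mulr1.
Qed.

Lemma kernel_pow_stationary p P t : transition_matrix P -> reversible p P ->
  stationary p (kernel_pow P t).
Proof.
move=> [_ P1] Prev; elim: t => [|t IH] y.
  under eq_bigr do rewrite kernel_pow0.
  rewrite (bigD1 y)//= eqxx mulr1 big1 ?addr0// => x /negPf ->.
  by rewrite mulr0.
under eq_bigr do rewrite -addn1 kernel_powD mulr_sumr.
rewrite exchange_big /=.
under eq_bigr => z _ do rewrite kernel_pow1.
under eq_bigr => z _ do under eq_bigr => x _ do rewrite mulrA.
(* Detailed balance turns [p z * P z y] into [p y * P y z], a multiple of a row entry of [P]. *)
under eq_bigr => z _ do rewrite -mulr_suml IH Prev.
by rewrite -mulr_sumr P1 mulr1.
Qed.

(** Eigenvectors are row vectors here, and right multiplication by a nonnegative matrix with unit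
    row sums does not increase the l1 norm. *)
Lemma eigenvalue_transition_le1 P l : transition_matrix P ->
  eigenvalue (kernel_mx P) l -> `|l| <= 1.
Proof.
move=> [P0 P1] /eigenvalueP[v vP vN0].
have S0 : 0 < \sum_i `|v 0 i|.
  rewrite lt_neqAle sumr_ge0 ?andbT; last by move=> *; exact: normr_ge0.
  apply: contra_neq vN0 => /esym/psumr_eq0P h.
  apply/rowP => i; rewrite mxE; apply/eqP; rewrite -normr_eq0; apply/eqP.
  by apply: h => // *; exact: normr_ge0.
rewrite -(ler_pM2r S0) mul1r mulr_sumr.
have -> : \sum_i `|l| * `|v 0 i| = \sum_i `|\sum_j v 0 j * kernel_mx P j i|.
  by apply: eq_bigr => i _; rewrite -normrM; move/rowP/(_ i): vP; rewrite !mxE => ->.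
apply: (@le_trans _ _ (\sum_i \sum_j `|v 0 j| * kernel_mx P j i)).
  apply: ler_sum => i _; apply: le_trans (ler_norm_sum _ _ _) _.
  by apply: ler_sum => j _; rewrite normrM mxE (ger0_norm (P0 _ _)).
rewrite exchange_big /=; apply: ler_sum => j _.
rewrite -mulr_sumr -[leRHS]mulr1 ler_wpM2l//.
rewrite -[leRHS](P1 (enum_val j))
  (reindex (fun i : 'I_#|X| => enum_val i)) /=; last first.
  exact: onW_bij (enum_val_bij X).
by apply: ler_sum => i _; rewrite mxE.
Qed.

Lemma lambda_star_ge0_le1 P : transition_matrix P -> 0 <= lambda_star P <= 1.
Proof.
move=> HP; rewrite /lambda_star; set A := [set _ | _ in _].
have Aub : ubound A 1.
  by move=> _ [l [le _] <-]; exact: eigenvalue_transition_le1 le.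
(* Without a real eigenvalue other than 1, the default [sup set0 = 0] is still in range. *)
have [->|A0] := eqVneq A set0; first by rewrite sup0 lexx ler01.
move/set0P: A0 => [a Aa]; apply/andP; split; last by apply: ge_sup => //; exists a.
apply: le_trans (ub_le_sup (ex_intro _ 1 Aub) Aa).
by case: Aa => l _ <-.
Qed.

End Powers.

(** * Comparison of mixing times *)

Section MixingTime.
Context {R : realType} {X : finType}.
Implicit Types (div : (X -> X -> R) -> R) (P : X -> X -> R).
Local Open Scope ereal_scope.

Lemma mixing_time_le div1 div2 (e1 e2 : R) P :
  (forall t, (div2 (kernel_pow P t) < e2)%R -> (div1 (kernel_pow P t) < e1)%R) ->
  mixing_time div1 e1 P <= mixing_time div2 e2 P.
Proof.
move=> h; apply: ereal_inf_le_tmp => _ [t [t0 td] <-].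
by exists t => //; split=> //; exact: h.
Qed.

(** Each time [t] admissible for [div1] makes [t * n] admissible for [div2], which gives the factor
    [n^-1]; multiplying by [l <= 1] only weakens this. The role of [l] will be played by
    [lambda_star P]. *)
Lemma mixing_time_scale div1 div2 (e l : R) n P : (0 <= l <= 1)%R -> (0 < n)%N ->
  (forall t, (div1 (kernel_pow P t) < e)%R -> (div2 (kernel_pow P (t * n)) < e)%R) ->
  (l / n%:R)%:E * mixing_time div2 e P <= mixing_time div1 e P.
Proof.
move=> /andP[l0 l1] n0 h; apply: le_ereal_inf_tmp => _ [t [t0 td] <-].
have h2 : mixing_time div2 e P <= ((t * n)%:R)%:E.
  apply: ge_ereal_inf; exists ((t * n)%:R)%:E => //.
  by exists (t * n)%N => //; split; [rewrite muln_gt0 t0|exact: h].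
have ln0 : 0 <= (l / n%:R)%:E by rewrite lee_fin divr_ge0.
apply: le_trans (lee_wpmul2l ln0 h2) _; rewrite -EFinM lee_fin natrM.
rewrite mulrAC mulrA mulfK ?pnatr_eq0 -?lt0n//.
by rewrite ler_piMl.
Qed.

End MixingTime.

(** * Divergences as means of row divergences *)

Section Rows.
Context {R : realType} {X : finType}.
Implicit Types (p : X -> R) (P Q : X -> X -> R).

Definition row_D a p Q x : R :=
  (a - 1)^-1 * (\sum_y p y * (Q x y / p y) `^ a - 1).

Definition dev p Q x y : R := Q x y / p y - 1.

Lemma row_D_tsallis a p Q x : pos_distribution p -> transition_matrix Q ->
  row_D a p Q x = \sum_y p y * tsallis a (1 + dev p Q x y).
Proof.
move=> [p0 p1] [_ Q1]; rewrite /row_D.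
have -> : \sum_y p y * tsallis a (1 + dev p Q x y) =
  (a - 1)^-1 * \sum_y (p y * (Q x y / p y) `^ a - p y - a * (Q x y - p y)).
  rewrite mulr_sumr; apply: eq_bigr => y _.
  rewrite /tsallis /dev subrKC; move: (_ `^ a) => w.
  have : p y != 0 by rewrite gt_eqF.
  by move=> py; rewrite mulrCA; congr (_ * _); field.
by rewrite !sumrB -mulr_sumr sumrB p1 Q1 subrr mulr0 subr0.
Qed.

Lemma avg_D_mean a p Q : pos_distribution p ->
  avg_D a p Q = \sum_x p x * row_D a p Q x.
Proof.
move=> [p0 p1]; rewrite /avg_D /row_D.
under [RHS]eq_bigr do rewrite mulrCA.
rewrite -mulr_sumr; congr (_ * _).
under [in RHS]eq_bigr do rewrite mulrBr mulr1 mulr_sumr.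
rewrite sumrB p1; congr (_ - _); apply: eq_bigr => x _; apply: eq_bigr => y _.
by rewrite mulrA.
Qed.

Lemma avg_TV_mean p Q : pos_distribution p ->
  avg_TV p Q = 2^-1 * \sum_x \sum_y p x * p y * `|dev p Q x y|.
Proof.
move=> [p0 p1]; congr (_ * _); apply: eq_bigr => x _; apply: eq_bigr => y _.
rewrite -mulrA; congr (_ * _).
have -> : Q x y - stationary_kernel p x y = p y * dev p Q x y.
  by rewrite /dev /stationary_kernel; field; rewrite gt_eqF.
by rewrite normrM gtr0_norm.
Qed.

(** If the sum of powers vanished, so would every [Q x y], against the unit row sum. Positivity
    keeps the argument of [ln] where [ln] is strictly increasing. *)
Lemma Renyi_sum_gt0 a p Q x : a != 1 -> pos_distribution p ->
  transition_matrix Q -> 0 < 1 + (a - 1) * row_D a p Q x.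
Proof.
move=> a1 [p0 p1] [Q0 Q1].
rewrite /row_D mulVKf ?subr_eq0// subrKC.
have term0 y : 0 <= p y * (Q x y / p y) `^ a by rewrite mulr_ge0 ?powR_ge0// ltW.
rewrite lt_neqAle sumr_ge0// andbT; apply/eqP => /esym/psumr_eq0P h.
have := Q1 x; rewrite big1 => [/esym/eqP|y _]; first by rewrite oner_eq0.
have /eqP := h (fun y _ => term0 y) y isT.
rewrite mulf_eq0 gt_eqF//= => /eqP/powR_eq0_eq0/eqP.
by rewrite mulf_eq0 invr_eq0 (gt_eqF (p0 y)) orbF => /eqP.
Qed.

Lemma avg_Renyi_sum_gt0 a p Q : a != 1 -> pos_distribution p ->
  transition_matrix Q -> 0 < 1 + (a - 1) * avg_D a p Q.
Proof.
move=> a1 p_dist HQ; have [p0 p1] := p_dist.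
have -> : 1 + (a - 1) * avg_D a p Q = \sum_x p x * (1 + (a - 1) * row_D a p Q x).
  under eq_bigr do rewrite mulrDr mulr1 mulrCA.
  by rewrite big_split /= p1 -mulr_sumr -avg_D_mean.
have [x _] := distribution_inhabited p_dist.
rewrite (bigD1 x)//= ltr_pwDl ?mulr_gt0 ?Renyi_sum_gt0//.
by apply: sumr_ge0 => y _; rewrite mulr_ge0 ?ltW ?Renyi_sum_gt0.
Qed.

End Rows.

(** * From average to worst case by doubling the time *)

Section Chain.
Context {R : realType} {X : finType} (p : X -> R) (P : X -> X -> R).
Context (p_dist : pos_distribution p) (P_trans : transition_matrix P)
  (P_rev : reversible p P).
Local Notation K := (kernel_pow P).
Local Notation v t := (dev p (K t)).
Local Notation m := (min_over p).

Let K_trans t : transition_matrix (K t) := kernel_pow_transition t P_trans.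
Let p_gt0 x : 0 < p x. Proof. by case: p_dist. Qed.
Let m_bounds : 0 < m <= 1.
Proof.
have [x _] := distribution_inhabited p_dist.
rewrite (min_over_gt0 x p_gt0)/=.
exact: le_trans (min_over_le p x) (distribution_le1 x p_dist).
Qed.

Lemma devD s t x y : v (s + t) x y = \sum_z p z * (v s x z * v t z y).
Proof.
have [p0 p1] := p_dist.
have -> : \sum_z p z * (v s x z * v t z y) =
  \sum_z (K s x z * K t z y / p y - K s x z - p z * K t z y / p y + p z).
  apply: eq_bigr => z _; rewrite /dev.
  by field; rewrite !gt_eqF.
(* The four sums are [K (s + t) x y / p y] and three ones: a row sum, stationarity divided by [p y],
   and the mass of [p]. *)
rewrite big_split !sumrB /= -!mulr_suml p1 (kernel_pow_stationary t P_trans P_rev).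
rewrite (K_trans s).2 -kernel_powD mulfV ?gt_eqF// /dev.
by rewrite -addrA addNr addr0.
Qed.

(** These are the hypotheses of [tsallis_ge_sqr] on a density: it is nonnegative, and at most [m^-1]
    because [K t x y <= 1]. *)
Lemma dev_bound t x y : (1 + v t x y) * m <= 1 /\ 0 <= 1 + v t x y.
Proof.
rewrite /dev subrKC; have [K0 K1] := K_trans t; split; last first.
  by rewrite divr_ge0// ltW.
have K1' : K t x y <= 1.
  by rewrite -(K1 x) (bigD1 y)//= lerDl; apply: sumr_ge0.
have [m0 m1] := andP m_bounds.
apply: (@le_trans _ _ (K t x y / p y * p y)).
  by rewrite ler_wpM2l ?min_over_le// divr_ge0// ltW.
by rewrite divfK ?gt_eqF.
Qed.

(** The threshold forces every deviation at time [t] to be at most 1. In the semigroup law one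
    factor is bounded by 1, and the other sums to [N], twice the average distance. *)
Lemma worst_TV_double t eps : eps < m ^+ 3 / 4 ->
  avg_TV p (K t) < eps -> worst_TV p (K (t * 2)) < eps.
Proof.
move=> epsm; rewrite avg_TV_mean//; set N := \sum_x _ => Neps.
have [x0 _] := distribution_inhabited p_dist.
have [m0 m1] := andP m_bounds.
have term0 x y : 0 <= p x * p y * `|v t x y| by rewrite !mulr_ge0 // ltW.
have v1 x y : `|v t x y| <= 1.
  have xyN : p x * p y * `|v t x y| <= N.
    rewrite /N (bigD1 x)//= (bigD1 y)//= -addrA lerDl addr_ge0 ?sumr_ge0// => z _.
    exact: sumr_ge0.
  have mxy : m ^+ 2 * `|v t x y| <= p x * p y * `|v t x y|.
    rewrite ler_wpM2r// expr2; apply: ler_pM; by [exact: ltW|exact: min_over_le].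
  have m3 : m ^+ 3 <= m ^+ 2 by rewrite ler_wiXn2l// ltW.
  have m2 := exprn_gt0 2 m0.
  rewrite -(ler_pM2l m2) mulr1; lra.
apply/(max_over_lt x0) => x; apply: le_lt_trans Neps; rewrite ler_pM2l//.
rewrite /N exchange_big /=; apply: ler_sum => y _.
have -> : K (t * 2) x y - p y = p y * v (t * 2) x y.
  by rewrite /dev; field; rewrite gt_eqF.
rewrite muln2 -addnn devD mulr_sumr; apply: le_trans (ler_norm_sum _ _ _) _.
apply: ler_sum => z _; rewrite !normrM !(gtr0_norm (p_gt0 _)).
have -> : p y * (p z * (`|v t x z| * `|v t z y|)) =
  `|v t x z| * (p z * p y * `|v t z y|) by ring.
by rewrite ler_piMl.
Qed.

Lemma avg_le_worst_TV Q : avg_TV p Q <= worst_TV p Q.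
Proof.
apply: le_trans (mean_le_max_over _ p_dist).
rewrite /avg_TV mulr_sumr; apply: ler_sum => x _.
by rewrite -mulr_sumr mulrCA.
Qed.

Lemma avg_le_worst_D a Q : avg_D a p Q <= worst_D a p Q.
Proof. by rewrite avg_D_mean//; exact: mean_le_max_over. Qed.

(** AM-GM in the semigroup law separates a row sum of squares from a column sum. As [p x] and [p y]
    are at least [m], each sum times [m] is below the chi-square. *)
Lemma dev_double_chi2 t x y :
  `|v (t * 2) x y| * m <= \sum_x \sum_y p x * p y * v t x y ^+ 2.
Proof.
set E := \sum_x _; have [m0 m1] := andP m_bounds.
have sq0 x' y' : 0 <= p x' * p y' * v t x' y' ^+ 2.
  by rewrite mulr_ge0 ?sqr_ge0// mulr_ge0 // ltW.
have rowE : \sum_z p z * v t x z ^+ 2 * m <= E.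
  rewrite /E [leRHS](bigD1 x)//= -[leLHS]addr0 lerD ?sumr_ge0//; last first.
    by move=> ? _; exact: sumr_ge0.
  apply: ler_sum => z _; rewrite mulrC mulrA ler_wpM2r ?sqr_ge0//.
  by rewrite ler_wpM2r ?min_over_le ?ltW.
have colE : \sum_z p z * v t z y ^+ 2 * m <= E.
  apply: ler_sum => z _; rewrite (bigD1 y)//= -[leLHS]addr0 lerD ?sumr_ge0//.
  by rewrite mulrAC ler_wpM2r ?sqr_ge0// ler_wpM2l ?min_over_le ?ltW.
suff : `|v (t * 2) x y| * m <=
    \sum_z (p z * v t x z ^+ 2 * m + p z * v t z y ^+ 2 * m) / 2.
  by rewrite -mulr_suml big_split /=; lra.
rewrite muln2 -addnn devD; apply: le_trans (ler_wpM2r (ltW m0) (ler_norm_sum _ _ _)) _.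
rewrite mulr_suml; apply: ler_sum => z _.
rewrite !normrM (gtr0_norm (p_gt0 z)) -mulrDl -mulrDr [leRHS]mulrAC ler_wpM2r ?(ltW m0)//.
rewrite -mulrA ler_pM2l// -(real_normK (num_real (v t x z))).
rewrite -(real_normK (num_real (v t z y))).
by have := sqr_ge0 (`|v t x z| - `|v t z y|); lra.
Qed.

Lemma dev_double_sup t B : (forall x y, `|v t x y| <= B) ->
  forall x y, `|v (t * 2) x y| <= B ^+ 2.
Proof.
move=> vB x y; rewrite muln2 -addnn devD; apply: le_trans (ler_norm_sum _ _ _) _.
rewrite -[leRHS]mul1r -p_dist.2 mulr_suml; apply: ler_sum => z _.
by rewrite !normrM (gtr0_norm (p_gt0 z)) ler_pM2l// expr2 ler_pM.
Qed.

(** The lower quadratic bound asks only that densities be at most [m^-1], so no smallness of the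
    deviation is assumed. *)
Lemma chi2_le_avg_D a t : 0 < a -> a != 1 ->
  Num.min a 1 * m / 4 * (\sum_x \sum_y p x * p y * v t x y ^+ 2) <=
  avg_D a p (K t).
Proof.
move=> a0 a1; rewrite avg_D_mean// mulr_sumr; apply: ler_sum => x _.
rewrite row_D_tsallis// !mulr_sumr; apply: ler_sum => y _.
rewrite mulrCA -!mulrA ler_pM2l// ler_pM2l// !mulrA.
have [um u0] := dev_bound t x y.
have := tsallis_ge_sqr a0 a1 m_bounds u0 um.
by rewrite [1 + _ - 1]addrAC subrr add0r expr2 !mulrA.
Qed.

(* [4 * k] bounds the deviation at time [2t]: it is [eps] divided by the
   chi-square constant [Num.min a 1 * m / 4] and by [m]. *)
Lemma deviation_below_eps0 a eps k : 0 < a -> a != 1 -> 0 < eps ->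
  eps < eps0 a p -> k = eps / (Num.min a 1 * m ^+ 2) ->
  [/\ (4 * k) ^+ 2 <= 1 / 2, a * (4 * k) ^+ 2 <= 1 / 2 &
      2 * a * ((4 * k) ^+ 2) ^+ 2 < eps].
Proof.
move=> a0 a1 e0; rewrite /eps0 !lt_min => /and4P[e1 _ e3 e4] kE.
have [m0 m1] := andP m_bounds.
have m2 : 0 < m ^+ 2 by rewrite exprn_gt0.
have m21 : m ^+ 2 <= 1 by rewrite exprn_ile1// ltW.
have eE : eps = k * (Num.min a 1 * m ^+ 2).
  by rewrite kE divfK// gt_eqF// mulr_gt0// lt_min a0 /=.
have k0 : 0 < k by rewrite kE divr_gt0// mulr_gt0// lt_min a0 /=.
have m6E : m ^+ 6 = m ^+ 2 * (m ^+ 2) ^+ 2 by ring.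
move: (m ^+ 2) (m ^+ 6) m2 m21 m6E eE e1 e3 e4 => n _ n0 n1 -> {}kE e1 e3 e4.
have n21 : n ^+ 2 <= n by rewrite expr2 ler_piMr // ltW.
have [a1'|a1'|/eqP] := ltgtP a 1; last by rewrite (negbTE a1).
  rewrite ltr0_norm ?subr_lt0// in e4.
  rewrite (min_l (ltW a1')) in kE.
  (* Here [n] is [m ^+ 2]. The last bound in [eps0] is divided by [a * n], and its factor [1 - a] is
     at most 1. *)
  have kn : k < n ^+ 2 / 2048.
    have an0 : 0 < a * n by rewrite mulr_gt0.
    rewrite -(ltr_pM2r an0) -kE; apply: (lt_le_trans e4).
    have : a * - (a - 1) * (n * n ^+ 2) <= a * (n * n ^+ 2).
      rewrite ler_pM2r ?mulr_gt0 ?exprn_gt0// ler_piMr ?ltW//; lra.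
    lra.
  have k1 : k <= 1 / 2048 by lra.
  have k2 : k ^+ 2 <= 1 / 2048 * k by rewrite expr2 ler_pM2r.
  have k4 : k ^+ 2 * k ^+ 2 <= (1 / 2048 * k) * (1 / 2048 * k).
    by rewrite ler_pM ?sqr_ge0.
  have ak2 : a * k ^+ 2 <= k ^+ 2 by rewrite ler_piMl ?sqr_ge0 ?ltW.
  split; [lra|lra|].
  have -> : 2 * a * ((4 * k) ^+ 2) ^+ 2 = 512 * a * (k ^+ 2 * k ^+ 2) by ring.
  rewrite kE.
  have kkn : k * k <= k * n by rewrite ler_pM2l//; lra.
  have kn0 : 0 < k * n by rewrite mulr_gt0.
  have : a * (512 * (k ^+ 2 * k ^+ 2)) < a * (k * n) by rewrite ltr_pM2l//; lra.
  lra.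
have b0 : 0 < a - 1 by lra.
rewrite gtr0_norm// in e1 e3.
rewrite (min_r (ltW a1')) mul1r in kE.
(* The first and third bounds in [eps0] are multiplied so that [a - 1] cancels, and
   [eps = k * n]. *)
have kn : a * k ^+ 2 <= n / 256.
  have h : eps * eps <= 1 / (2 * (a - 1)) * ((a - 1) * (n * n ^+ 2) / (128 * a)).
    by rewrite ler_pM ?ltW.
  have hE : 1 / (2 * (a - 1)) * ((a - 1) * (n * n ^+ 2) / (128 * a)) =
            n ^+ 3 / 256 / a.
    by field; rewrite !gt_eqF.
  rewrite hE kE ler_pdivlMr// in h.
  rewrite -(ler_pM2r (exprn_gt0 2 n0)); lra.
have k2 : k ^+ 2 <= a * k ^+ 2 by rewrite ler_peMl ?sqr_ge0 ?ltW.
have k16 : k <= 1 / 16.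
  rewrite leNgt; apply/negP => hk.
  have : 1 / 16 * (1 / 16) < k * k by rewrite ltr_pM//; lra.
  lra.
split; [lra|lra|].
have h : a * k ^+ 2 * k ^+ 2 <= n / 256 * k ^+ 2 by rewrite ler_wpM2r ?sqr_ge0.
have h' : n * k * k <= n * k * (1 / 16) by rewrite ler_pM2l// mulr_gt0.
have nk0 : 0 < n * k by rewrite mulr_gt0.
rewrite kE; lra.
Qed.

(** The first doubling converts the chi-square into the pointwise bound [4 * k] at time [2t]; the
    second squares it at time [4t], where the deviation is small enough for [tsallis_le]. *)
Lemma worst_D_quadruple a t eps : 0 < a -> a != 1 -> 0 < eps ->
  eps < eps0 a p -> avg_D a p (K t) < eps -> worst_D a p (K (t * 4)) < eps.
Proof.
move=> a0 a1 e0 ee Deps; have [m0 m1] := andP m_bounds.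
have [w2 aw2 awe] := deviation_below_eps0 a0 a1 e0 ee erefl.
set k := eps / _ in w2 aw2 awe.
have min0 : 0 < Num.min a 1 by rewrite lt_min a0 /=.
have vk x y : `|v (t * 2) x y| <= 4 * k.
  have h1 := dev_double_chi2 t x y.
  have c0 : 0 < Num.min a 1 * m / 4 by rewrite divr_gt0// mulr_gt0.
  have := le_trans (ler_wpM2l (ltW c0) h1) (le_trans (chi2_le_avg_D t a0 a1) (ltW Deps)).
  rewrite /k mulrA ler_pdivlMr ?mulr_gt0 ?exprn_gt0//; lra.
have := dev_double_sup vk; rewrite -mulnA => vw.
have [x0 _] := distribution_inhabited p_dist.
apply/(max_over_lt x0) => x.
rewrite -/(row_D a p (K (t * 4)) x) row_D_tsallis//; apply: le_lt_trans awe.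
rewrite -[leRHS]mul1r -[X in _ <= X * _]p_dist.2 mulr_suml; apply: ler_sum => y _.
rewrite ler_pM2l//; have vxy := vw x y.
apply: le_trans (tsallis_le a0 a1 _ _) _.
- exact: le_trans vxy w2.
- by apply: le_trans aw2; rewrite ler_pM2l.
- rewrite ler_pM2l ?mulr_gt0// -(real_normK (num_real (v (t * 4) x y))).
  by rewrite ler_pXn2r ?nnegrE ?sqr_ge0.
Qed.

End Chain.

(** * Reduction of the Rényi divergence to the Tsallis divergence *)

Section Renyi.
Context {R : realType} {X : finType}.
Implicit Types (a s e : R) (p : X -> R) (Q : X -> X -> R).

Definition Renyi a s : R := (a - 1)^-1 * ln (1 + (a - 1) * s).
Definition Renyi_inv a e : R := (a - 1)^-1 * (expR ((a - 1) * e) - 1).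

Lemma Renyi_inv_gt0 a e : a != 1 -> 0 < 1 + (a - 1) * Renyi_inv a e.
Proof. by move=> a1; rewrite mulVKf ?subr_eq0// subrKC expR_gt0. Qed.

Lemma Renyi_invK a e : a != 1 -> Renyi a (Renyi_inv a e) = e.
Proof.
by move=> a1; rewrite /Renyi mulVKf ?subr_eq0// subrKC expRK mulKf ?subr_eq0.
Qed.

(** For [a < 1] the prefactor and the argument of [ln] both reverse the order, so the map is
    increasing in either case. *)
Lemma Renyi_lt a s s' : a != 1 -> 0 < 1 + (a - 1) * s ->
  0 < 1 + (a - 1) * s' -> (Renyi a s < Renyi a s') = (s < s').
Proof.
move=> a1 s0 s'0; rewrite /Renyi.
have [a1'|a1'|/eqP] := ltgtP a 1; last by rewrite (negbTE a1).
  by rewrite ltr_nM2l ?invr_lt0 ?subr_lt0// ltr_ln// ltrD2l ltr_nM2l// subr_lt0.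
by rewrite ltr_pM2l ?invr_gt0 ?subr_gt0// ltr_ln// ltrD2l ltr_pM2l// subr_gt0.
Qed.

(** Together with [worst_R_lt], this identifies the mixing times of [R_alpha] at [e] with those of
    [D_alpha] at [Renyi_inv a e]. *)
Lemma avg_R_lt a e p Q : a != 1 -> pos_distribution p -> transition_matrix Q ->
  (avg_R a p Q < e) = (avg_D a p Q < Renyi_inv a e).
Proof.
move=> a1 p_dist HQ; rewrite -{1}(Renyi_invK e a1) Renyi_lt//.
  exact: avg_Renyi_sum_gt0.
exact: Renyi_inv_gt0.
Qed.

Lemma worst_R_lt a e p Q : a != 1 -> pos_distribution p -> transition_matrix Q ->
  (worst_R a p Q < e) <-> (worst_D a p Q < Renyi_inv a e).
Proof.
move=> a1 p_dist HQ; have [x0 _] := distribution_inhabited p_dist.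
have rowE x : ((a - 1)^-1 * ln (\sum_y p y * (Q x y / p y) `^ a) < e) =
              (row_D a p Q x < Renyi_inv a e).
  rewrite -[RHS](Renyi_lt a1) ?Renyi_sum_gt0 ?Renyi_inv_gt0// Renyi_invK//.
  by rewrite /Renyi /row_D mulVKf ?subr_eq0// subrKC.
split=> /(max_over_lt x0) h; apply/(max_over_lt x0) => x; have := h x;
  by rewrite rowE.
Qed.

End Renyi.

Theorem theorem4p4 (R : realType) (X : finType) (p : X -> R) (P : X -> X -> R)
    (p_dist : pos_distribution p)
    (P_trans : transition_matrix P)
    (P_irr : irreducible_chain P)
    (P_aper : aperiodic_chain P)
    (P_rev : reversible p P)
    (eps : R) (eps_gt0 : 0 < eps) :
  [/\
   eps < min_over p ^+ 3 / 4 ->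
     ((((1 - abs_spectral_gap P) / 2)%:E * mixing_time (worst_TV p) eps P
        <= mixing_time (avg_TV p) eps P)%E /\
      (mixing_time (avg_TV p) eps P <= mixing_time (worst_TV p) eps P)%E),
   forall alpha : R, 0 < alpha -> alpha != 1 ->
     eps < eps0 alpha p ->
     ((((1 - abs_spectral_gap P) / 4)%:E * mixing_time (worst_D alpha p) eps P
        <= mixing_time (avg_D alpha p) eps P)%E /\
      (mixing_time (avg_D alpha p) eps P
        <= mixing_time (worst_D alpha p) eps P)%E)
   & forall alpha : R, 0 < alpha -> alpha != 1 ->
     eps < (alpha - 1)^-1 * ln (1 + (alpha - 1) * eps0 alpha p) ->
     ((((1 - abs_spectral_gap P) / 4)%:E * mixing_time (worst_R alpha p) eps P
        <= mixing_time (avg_R alpha p) eps P)%E /\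
      (mixing_time (avg_R alpha p) eps P
        <= mixing_time (worst_R alpha p) eps P)%E)].
Proof.
have gapE : 1 - abs_spectral_gap P = lambda_star P by rewrite subKr.
have lam := lambda_star_ge0_le1 P_trans.
rewrite gapE.
(* The threshold [e] is kept general because the Rényi case uses it at [Renyi_inv alpha eps]. *)
have D_bounds alpha e : 0 < alpha -> alpha != 1 -> 0 < e -> e < eps0 alpha p ->
    (((lambda_star P / 4)%:E * mixing_time (worst_D alpha p) e P
        <= mixing_time (avg_D alpha p) e P)%E /\
     (mixing_time (avg_D alpha p) e P <= mixing_time (worst_D alpha p) e P)%E).
  move=> a0 a1 e0 ee; split.
    by apply: (@mixing_time_scale _ _ _ _ _ _ 4) => // t; exact: worst_D_quadruple.
  by apply: mixing_time_le => t; apply: le_lt_trans; exact: avg_le_worst_D.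
split=> [epsm|alpha a0 a1 ee|alpha a0 a1 ee]; [|exact: D_bounds|].
- split.
    by apply: (@mixing_time_scale _ _ _ _ _ _ 2) => // t; exact: worst_TV_double.
  by apply: mixing_time_le => t; apply: le_lt_trans; exact: avg_le_worst_TV.
- have K_trans t := kernel_pow_transition t P_trans.
  have -> : mixing_time (avg_R alpha p) eps P =
            mixing_time (avg_D alpha p) (Renyi_inv alpha eps) P.
    by apply/eqP; rewrite eq_le !mixing_time_le// => t; rewrite avg_R_lt.
  have -> : mixing_time (worst_R alpha p) eps P =
            mixing_time (worst_D alpha p) (Renyi_inv alpha eps) P.
    by apply/eqP; rewrite eq_le !mixing_time_le// => t
      /(worst_R_lt _ a1 p_dist (K_trans t)).
  have eps0_pos : 0 < 1 + (alpha - 1) * eps0 alpha p.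
    (* On a nonpositive argument [ln] is 0 by default, and the hypothesis would read [eps < 0]. *)
    rewrite ltNge; apply/negP => /ln0 ln_eq0; move: ee.
    by rewrite ln_eq0 mulr0 ltNge ltW.
  apply: D_bounds => //.
    (* [Renyi] sends 0 to 0 and is increasing, so the sign of the threshold is preserved. *)
    rewrite -(Renyi_lt a1) ?mulr0 ?addr0 ?ltr01 ?Renyi_inv_gt0// Renyi_invK//.
    by rewrite /Renyi mulr0 addr0 ln1 mulr0.
  by rewrite -(Renyi_lt a1) ?Renyi_inv_gt0// Renyi_invK.
Qed.
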